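(* Let $X_1,X_2,\dots$ be i.i.d. generalised random variables on $\mathbb{R}$ with common pair $(T,\varphi)$, $T\in\mathcal{S}'(\mathbb{R})$, $\varphi\in\mathcal{S}(\mathbb{R})$, normalised by $\langle T,\varphi\rangle=1$, with weak characteristic function ${}^{(\varphi)}\phi$ and weak cumulants ${}^{(\varphi)}\kappa_1\in\mathbb{R}$, ${}^{(\varphi)}\kappa_2>0$. Suppose that ${}^{(\varphi)}K(t):=\log{}^{(\varphi)}\phi(t)$ is $C^3$ in a neighbourhood of $0$. Let $S_n=X_1+\dots+X_n$ and $Z_n=(S_n-n\,{}^{(\varphi)}\kappa_1)/\sqrt{n\,{}^{(\varphi)}\kappa_2}$. Then for every $\tau>0$, as $n\to\infty$, $$\sup_{|t|\le\tau}\left|\log{}^{(\varphi)}\phi_{Z_n}(t)+\frac{t^2}{2}\right|=O\!\left(\frac1{\sqrt n}\right),$$ and consequently $$\sup_{|t|\le\tau}\left|{}^{(\varphi)}\phi_{Z_n}(t)-e^{-t^2/2}\right|=O\!\left(\frac1{\sqrt n}\right).$$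
   Context: $\mathcal{S}$, $\mathcal{S}'$ denote Schwartz functions and tempered distributions. The weak characteristic function of a pair $(T,\varphi)$ is ${}^{(\varphi)}\phi(t):=\langle T,e^{itx}\varphi(x)\rangle$; near $0$, $\log{}^{(\varphi)}\phi$ is the continuous branch vanishing at $0$, and the weak cumulants are ${}^{(\varphi)}\kappa_n:=i^{-n}\frac{d^n}{dt^n}{}^{(\varphi)}K(t)\big|_{t=0}$. I.i.d. means the joint representation of $X_1,\dots,X_n$ is the $n$-fold tensor product pair $(T^{\otimes n},\varphi^{\otimes n})$; accordingly the weak characteristic function of $Z_n$ is $${}^{(\varphi)}\phi_{Z_n}(t)=\exp\!\left(-it\frac{n\,{}^{(\varphi)}\kappa_1}{\sqrt{n\,{}^{(\varphi)}\kappa_2}}\right)\left({}^{(\varphi)}\phi\!\left(\frac{t}{\sqrt{n\,{}^{(\varphi)}\kappa_2}}\right)\right)^{n},$$ and (for $|t|\le\tau$ and $n$ large enough that the argument lies in the neighbourhood where ${}^{(\varphi)}K$ is defined) $\log{}^{(\varphi)}\phi_{Z_n}(t)=-it\frac{n\,{}^{(\varphi)}\kappa_1}{\sqrt{n\,{}^{(\varphi)}\kappa_2}}+n\,{}^{(\varphi)}K\bigl(t/\sqrt{n\,{}^{(\varphi)}\kappa_2}\bigr)$. *)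

(* Defs.v *)
From Stdlib Require Import Reals.
From mathcomp Require Import ssreflect ssrfun ssrbool eqtype ssrnat seq fintype bigop.
From Coquelicot Require Import Coquelicot.

Local Open Scope R_scope.

Definition Cexp (z : C) : C :=
  (exp (Re z) * cos (Im z), exp (Re z) * sin (Im z)).

(** * Complex-valued functions of a real variable

    They are differentiated componentwise. *)

Definition CDerive_n (f : R -> C) (k : nat) (x : R) : C :=
  (Derive_n (fun y => Re (f y)) k x, Derive_n (fun y => Im (f y)) k x).

Definition ex_CDerive_n (f : R -> C) (k : nat) (x : R) : Prop :=
  ex_derive_n (fun y => Re (f y)) k x /\ ex_derive_n (fun y => Im (f y)) k x.

(** Meant for an open set [D]. *)
Definition Ck_on (D : R -> Prop) (m : nat) (f : R -> C) : Prop :=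
  forall k x, (k <= m)%N -> D x ->
    ex_CDerive_n f k x /\ continuous (CDerive_n f k) x.

(** * Schwartz functions and tempered distributions

    A distribution is represented by a total functional [T] on all functions
    [X -> C]; only its restriction to the Schwartz functions is constrained, and
    only that restriction is meaningful. *)

Definition schwartz_bound (N : nat) (f : R -> C) (B : R) : Prop :=
  forall j k x, (j <= N)%N -> (k <= N)%N ->
    Rabs (x ^ j) * Cmod (CDerive_n f k x) <= B.

Definition schwartz (f : R -> C) : Prop :=
  (forall m, Ck_on (fun _ => True) m f) /\
  (forall N, exists B, schwartz_bound N f B).

(** [R^n] is ['I_n -> R], with the sup distance ([fct_UniformSpace]). *)

Definition upd {n : nat} (x : 'I_n -> R) (i : 'I_n) (s : R) : 'I_n -> R :=
  fun j => if j == i then s else x j.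

Definition pderiv {n : nat} (i : 'I_n) (f : ('I_n -> R) -> C)
    (x : 'I_n -> R) : C :=
  (Derive (fun s => Re (f (upd x i s))) (x i),
   Derive (fun s => Im (f (upd x i s))) (x i)).

Definition ex_pderiv {n : nat} (i : 'I_n) (f : ('I_n -> R) -> C)
    (x : 'I_n -> R) : Prop :=
  ex_derive (fun s => Re (f (upd x i s))) (x i) /\
  ex_derive (fun s => Im (f (upd x i s))) (x i).

(** Multi-indices are lists of coordinates, with repetitions: [[:: i; i; j]]
    stands for the derivative [d_i d_i d_j], or for the monomial
    [x_i * x_i * x_j]. *)
Definition pderivs {n : nat} (b : seq 'I_n) (f : ('I_n -> R) -> C) :
    ('I_n -> R) -> C :=
  foldr pderiv f b.

Definition monomial {n : nat} (a : seq 'I_n) (x : 'I_n -> R) : R :=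
  \big[Rmult/1]_(i <- a) x i.

Definition smooth_n {n : nat} (f : ('I_n -> R) -> C) : Prop :=
  forall (b : seq 'I_n) (x : 'I_n -> R),
    continuous (pderivs b f) x /\ forall i, ex_pderiv i (pderivs b f) x.

Definition schwartz_bound_n {n : nat} (N : nat) (f : ('I_n -> R) -> C)
    (B : R) : Prop :=
  forall (a b : seq 'I_n) (x : 'I_n -> R), (size a <= N)%N -> (size b <= N)%N ->
    Rabs (monomial a x) * Cmod (pderivs b f x) <= B.

Definition schwartz_n {n : nat} (f : ('I_n -> R) -> C) : Prop :=
  smooth_n f /\ (forall N, exists B, schwartz_bound_n N f B).

(** A C-linear form on the test functions [S], continuous for the seminorms
    [p_N f := inf {B | bound N f B}]: some [M] and [N] satisfy
    [|T f| <= M * p_N f] for every test function [f].  The [p_N] increase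
    with [N], so one of them suffices. *)
Definition continuous_linear_form {X : Type} (S : (X -> C) -> Prop)
    (bound : nat -> (X -> C) -> R -> Prop) (T : (X -> C) -> C) : Prop :=
  (forall f g, S f -> S g ->
     T (fun x => Cplus (f x) (g x)) = Cplus (T f) (T g)) /\
  (forall (c : C) f, S f -> T (fun x => Cmult c (f x)) = Cmult c (T f)) /\
  (exists (N : nat) (M : R), 0 <= M /\
     forall f B, S f -> bound N f B -> Cmod (T f) <= M * B).

Definition tempered (T : (R -> C) -> C) : Prop :=
  continuous_linear_form schwartz schwartz_bound T.

Definition tempered_n {n : nat} (T : (('I_n -> R) -> C) -> C) : Prop :=
  continuous_linear_form schwartz_n schwartz_bound_n T.

(** * Tensor powers and i.i.d. generalised random variables *)

Definition tensor {n : nat} (f : 'I_n -> R -> C) (x : 'I_n -> R) : C :=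
  \big[Cmult/RtoC 1]_(i < n) f i (x i).

Definition is_tensor_power {n : nat} (T : (R -> C) -> C)
    (Tn : (('I_n -> R) -> C) -> C) : Prop :=
  tempered_n Tn /\
  forall f : 'I_n -> R -> C, (forall i, schwartz (f i)) ->
    Tn (tensor f) = \big[Cmult/RtoC 1]_(i < n) T (f i).

(** [(TT n, Phi n)] is the joint representation of [X_1, ..., X_n]. *)
Definition iid (T : (R -> C) -> C) (phi : R -> C)
    (TT : forall n, (('I_n -> R) -> C) -> C)
    (Phi : forall n, ('I_n -> R) -> C) : Prop :=
  forall n, is_tensor_power T (TT n) /\ Phi n = tensor (fun _ : 'I_n => phi).

(** * Weak characteristic functions and cumulants *)

(** Weak characteristic function of the real function [g] of a generalised
    random variable with representation [(T, phi)] on the space [X]. *)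
Definition weak_cf {X : Type} (T : (X -> C) -> C) (phi : X -> C) (g : X -> R)
    (t : R) : C :=
  T (fun x => Cmult (Cexp (Cmult Ci (RtoC (t * g x)))) (phi x)).

(** [L] is the continuous branch of [log f] on [D] vanishing at [0]. It is
    unique on [D] when [D] is an interval containing [0]. *)
Definition log_branch (D : R -> Prop) (f L : R -> C) : Prop :=
  L 0 = RtoC 0 /\ continuous_on D L /\ forall t, D t -> Cexp (L t) = f t.

Definition weak_cumulant (K : R -> C) (k : nat) : C :=
  Cmult (Cinv (Cpow Ci k)) (CDerive_n K k 0).

Definition Zstd (kappa1 kappa2 : R) (n : nat) (x : 'I_n -> R) : R :=
  ((\big[Rplus/0]_(i < n) x i) - INR n * kappa1) / sqrt (INR n * kappa2).

(** * Asymptotics *)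

Definition sup_le (tau : R) (h : R -> R) : Rbar :=
  Lub_Rbar (fun y => exists t, Rabs t <= tau /\ y = h t).

(** [a n = O(1 / sqrt n)], for a nonnegative sequence [a]. *)
Definition O_inv_sqrt (a : nat -> Rbar) : Prop :=
  exists A : R, eventually (fun n => Rbar_le (a n) (A / sqrt (INR n))).

(* Main.v *)
Require Import Defs.
From Stdlib Require Import Reals Lra Lia FunctionalExtensionality.
From mathcomp Require Import ssreflect ssrfun ssrbool eqtype ssrnat seq fintype bigop.
From Coquelicot Require Import Coquelicot.
Local Open Scope R_scope.

(** The function defining [phi_{Z_n}(t)] on [R^n] is the tensor product of [n]
    copies of [x |-> e^{iu(x - kappa1)} phi(x)] with [u = t / sqrt (n kappa2)]:
    the centering constant is spread over the factors, so that the defining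
    property of [T^{(x)n}] applies directly and only linearity of [T] in one
    variable is needed.  Hence [phi_{Z_n}(t) = exp (n (K(u) - i u kappa1))] as
    soon as [|u| < delta].  Taylor's formula at order 3 turns the exponent into
    [- t^2 / 2 + O(n |u|^3)], and [n |u|^3 = O(1 / sqrt n)] uniformly in
    [|t| <= tau]. *)

(** * Componentwise limits in [C] and the complex exponential *)

Lemma filterlim_C_pair {U : Type} (F : (U -> Prop) -> Prop) {FF : Filter F}
    (f g : U -> R) (z : C) :
  filterlim f F (locally (Re z)) -> filterlim g F (locally (Im z)) ->
  filterlim (fun x => (f x, g x) : C) F (locally z).
Proof.
  move=> hf hg.
  apply/filterlim_locally => eps.
  have h1 := proj1 (@filterlim_locally _ _ F FF f _) hf eps.
  have h2 := proj1 (@filterlim_locally _ _ F FF g _) hg eps.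
  exact: (@filter_imp U F FF _ _ (fun x h => h) (@filter_and U F FF _ _ h1 h2)).
Qed.

Lemma filterlim_Re (z : C) : filterlim Re (locally z) (locally (Re z)).
Proof. case: z => x y; exact: (@continuous_fst R_UniformSpace R_UniformSpace). Qed.

Lemma filterlim_Im (z : C) : filterlim Im (locally z) (locally (Im z)).
Proof. case: z => x y; exact: (@continuous_snd R_UniformSpace R_UniformSpace). Qed.

Lemma Cexp_plus (z w : C) : Cexp (Cplus z w) = Cmult (Cexp z) (Cexp w).
Proof.
  rewrite /Cexp /Cmult /Re /Im /= exp_plus cos_plus sin_plus.
  congr pair; ring.
Qed.

(** * Multiplication by a unimodular phase preserves Schwartz functions *)

(** Only existence of the derivatives is asked: continuity of each follows from existence of the
    next ([smooth_Ck]). *)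
Definition smooth (f : R -> C) : Prop :=
  forall k x, ex_CDerive_n f k x.

Lemma CDerive_n0 (f : R -> C) x : CDerive_n f 0 x = f x.
Proof. by rewrite /CDerive_n /=; case: (f x). Qed.

Definition phase (u a x : R) : C := Cexp (Cmult Ci (RtoC (u * (x - a)))).

Lemma phaseE (u a x : R) : phase u a x = (cos (u * (x - a)), sin (u * (x - a))).
Proof.
  rewrite /phase /Cexp /=.
  have -> : 0 * (u * (x - a)) - 1 * 0 = 0 by ring.
  have -> : 0 * 0 + 1 * (u * (x - a)) = u * (x - a) by ring.
  rewrite exp_0; congr pair; ring.
Qed.

Lemma Cmod_phase (u a x : R) : Cmod (phase u a x) = 1.
Proof.
  rewrite phaseE /Cmod -[RHS]sqrt_1; congr sqrt => /=.
  have := sin2_cos2 (u * (x - a)); rewrite /Rsqr => h; rewrite -[RHS]h; ring.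
Qed.

(* [d/dx (phase u a * f) = phase u a * twist u f]. *)
Definition twist (u : R) (f : R -> C) (x : R) : C :=
  Cplus (CDerive_n f 1 x) (Cmult (0, u) (f x)).

Lemma Re_twist (u : R) (f : R -> C) x :
  Re (twist u f x) = Derive (fun y => Re (f y)) x - u * Im (f x).
Proof. rewrite /twist /CDerive_n /=; rewrite /Re /Im; ring. Qed.

Lemma Im_twist (u : R) (f : R -> C) x :
  Im (twist u f x) = Derive (fun y => Im (f y)) x - - u * Re (f x).
Proof. rewrite /twist /CDerive_n /=; rewrite /Re /Im; ring. Qed.

(** Serves both components of [twist]: the real part with [u], the imaginary part with [- u] and the
    two functions exchanged. *)
Lemma smooth_derive_comb (f g : R -> R) (u : R)
    (hf : forall k x, ex_derive_n f k x) (hg : forall k x, ex_derive_n g k x) k x :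
  ex_derive_n (fun y => Derive f y - u * g y) k x /\
  Derive_n (fun y => Derive f y - u * g y) k x = Derive_n f k.+1 x - u * Derive_n g k x.
Proof.
  have hf' : forall k y, ex_derive_n (Derive f) k y.
    case=> [|m] y //=.
    apply: (ex_derive_ext (Derive_n f m.+1)); last exact: (hf m.+2 y).
    by move=> t; rewrite -[m.+1]addn1 -(Derive_n_comp f m 1).
  have hg' : forall k y, ex_derive_n (fun y => u * g y) k y.
    move=> m y; exact: ex_derive_n_scal_l.
  split.
    apply: (ex_derive_n_minus (Derive f) (fun y => u * g y)); exact: filter_forall.
  rewrite (Derive_n_minus (Derive f) (fun y => u * g y)); try exact: filter_forall.
  by rewrite Derive_n_scal_l -[k.+1]addn1 -(Derive_n_comp f k 1).
Qed.

Lemma smooth_twist (u : R) (f : R -> C) :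
  smooth f -> smooth (twist u f).
Proof.
  move=> hf k x; split.
  - apply: (ex_derive_n_ext (fun y => Derive (fun y => Re (f y)) y - u * Im (f y))).
      by move=> t; rewrite Re_twist.
    by apply: (proj1 (smooth_derive_comb _ _ _ _ _ _ _)) => m y; case: (hf m y).
  - apply: (ex_derive_n_ext (fun y => Derive (fun y => Im (f y)) y - - u * Re (f y))).
      by move=> t; rewrite Im_twist.
    by apply: (proj1 (smooth_derive_comb _ _ _ _ _ _ _)) => m y; case: (hf m y).
Qed.

Lemma CDerive_n_twist (u : R) (f : R -> C) k x : smooth f ->
  CDerive_n (twist u f) k x =
  Cplus (CDerive_n f k.+1 x) (Cmult (0, u) (CDerive_n f k x)).
Proof.
  move=> hf.
  have hr : forall m y, ex_derive_n (fun y => Re (f y)) m y by move=> m y; case: (hf m y).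
  have hi : forall m y, ex_derive_n (fun y => Im (f y)) m y by move=> m y; case: (hf m y).
  rewrite {1}/CDerive_n.
  rewrite (Derive_n_ext _ _ _ _ (Re_twist u f)) (Derive_n_ext _ _ _ _ (Im_twist u f)).
  rewrite (proj2 (smooth_derive_comb _ _ u hr hi k x)).
  rewrite (proj2 (smooth_derive_comb _ _ (- u) hi hr k x)).
  rewrite /CDerive_n /Cplus /Cmult /=; congr pair; ring.
Qed.

Lemma Re_phase_mult (u a : R) (f : R -> C) (x : R) :
  Re (Cmult (phase u a x) (f x)) =
  cos (u * (x - a)) * Re (f x) - sin (u * (x - a)) * Im (f x).
Proof. by rewrite phaseE. Qed.

Lemma Im_phase_mult (u a : R) (f : R -> C) (x : R) :
  Im (Cmult (phase u a x) (f x)) =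
  cos (u * (x - a)) * Im (f x) + sin (u * (x - a)) * Re (f x).
Proof. by rewrite phaseE. Qed.

(** The pair [(p, q)] is [(Re f, Im f)] for the real part of the product and [(Im f, - Re f)] for
    the imaginary part, so one computation covers both. *)
Lemma is_derive_rotation (p q : R -> R) (u a x : R) :
  ex_derive p x -> ex_derive q x ->
  is_derive (fun y => cos (u * (y - a)) * p y - sin (u * (y - a)) * q y) x
    (cos (u * (x - a)) * (Derive p x - u * q x) -
     sin (u * (x - a)) * (Derive q x + u * p x)).
Proof.
  move=> hp hq; auto_derive; [by [] | rewrite /Rminus].
  change (Derive (fun y => p y) x) with (Derive p x).
  change (Derive (fun y => q y) x) with (Derive q x).
  ring.
Qed.

Lemma is_derive_phase_mult (u a : R) (f : R -> C) (x : R) :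
  ex_CDerive_n f 1 x ->
  is_derive (fun y => Re (Cmult (phase u a y) (f y))) x
    (Re (Cmult (phase u a x) (twist u f x))) /\
  is_derive (fun y => Im (Cmult (phase u a y) (f y))) x
    (Im (Cmult (phase u a x) (twist u f x))).
Proof.
  case=> hr hi; rewrite Re_phase_mult Im_phase_mult Re_twist Im_twist.
  split.
  - apply: (is_derive_ext (fun x => cos (u * (x - a)) * Re (f x) - sin (u * (x - a)) * Im (f x))).
      by move=> t; rewrite Re_phase_mult.
    have := is_derive_rotation _ _ u a x hr hi.
    by congr is_derive; rewrite /=; ring.
  - apply: (is_derive_ext (fun x => cos (u * (x - a)) * Im (f x) - sin (u * (x - a)) * - Re (f x))).
      by move=> t; rewrite Im_phase_mult -Ropp_mult_distr_r /Rminus Ropp_involutive.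
    have hr' : ex_derive (fun y => - Re (f y)) x by exact: ex_derive_opp hr.
    have := is_derive_rotation _ _ u a x hi hr'.
    rewrite Derive_opp.
    by congr is_derive; rewrite /=; ring.
Qed.

Lemma smooth_iter_twist (u : R) (f : R -> C) k :
  smooth f -> smooth (iter k (twist u) f).
Proof. by move=> hf; elim: k => //= k; apply: smooth_twist. Qed.

(** Each differentiation leaves the phase in front and applies one more [twist]; iterating this
    replaces Leibniz's formula and its binomial sums. *)
Lemma CDerive_n_phase_mult (u a : R) (f : R -> C) k x : smooth f ->
  CDerive_n (fun y => Cmult (phase u a y) (f y)) k x =
  Cmult (phase u a x) (iter k (twist u) f x).
Proof.
  move=> hf; elim: k x => [|k IH] x.
    exact: CDerive_n0.
  have [hr hi] := is_derive_phase_mult u a (iter k (twist u) f) x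
    (smooth_iter_twist u f k hf 1%N x).
  rewrite /CDerive_n /=.
  rewrite (Derive_ext _ _ _ (fun y => f_equal Re (IH y))).
  rewrite (Derive_ext _ _ _ (fun y => f_equal Im (IH y))).
  by rewrite (is_derive_unique _ _ _ hr) (is_derive_unique _ _ _ hi).
Qed.

Lemma smooth_phase_mult (u a : R) (f : R -> C) : smooth f ->
  smooth (fun y => Cmult (phase u a y) (f y)).
Proof.
  move=> hf [|k] x; first by split.
  have [hr hi] := is_derive_phase_mult u a (iter k (twist u) f) x
    (smooth_iter_twist u f k hf 1%N x).
  split=> /=; eexists.
  - apply: is_derive_ext hr => y.
    by rewrite -(CDerive_n_phase_mult u a f k y hf).
  - apply: is_derive_ext hi => y.
    by rewrite -(CDerive_n_phase_mult u a f k y hf).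
Qed.

Lemma smooth_Ck (f : R -> C) m : smooth f -> Ck_on (fun _ => True) m f.
Proof.
  move=> hf k x _ _; split; first exact: hf.
  have [hr hi] := hf k.+1 x.
  by apply: filterlim_C_pair; apply: ex_derive_continuous.
Qed.

(** One order is lost because [twist] contains [f']; the factor is the triangle inequality applied
    to [f' + i u f]. *)
Lemma schwartz_bound_twist (u : R) (f : R -> C) N B : smooth f ->
  schwartz_bound N.+1 f B -> schwartz_bound N (twist u f) ((1 + Rabs u) * B).
Proof.
  move=> hf hB j k x hj hk.
  rewrite CDerive_n_twist //.
  have h1 := hB j k.+1 x (leqW hj) hk.
  have h2 := hB j k x (leqW hj) (leqW hk).
  have h3 := Cmod_triangle (CDerive_n f k.+1 x) (Cmult (0, u) (CDerive_n f k x)).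
  have hu : Cmod (0, u) = Rabs u.
    by rewrite /Cmod /= -sqrt_Rsqr_abs /Rsqr; congr sqrt; ring.
  rewrite Cmod_mult hu in h3.
  have := Rabs_pos (x ^ j); have := Rabs_pos u.
  nra.
Qed.

Lemma schwartz_bound_iter_twist (u : R) (f : R -> C) N k B : smooth f ->
  schwartz_bound (k + N) f B ->
  schwartz_bound N (iter k (twist u) f) ((1 + Rabs u) ^ k * B).
Proof.
  move=> hf; elim: k N => [|k IH] N hB /=; first by rewrite Rmult_1_l.
  rewrite Rmult_assoc; apply: schwartz_bound_twist; first exact: smooth_iter_twist.
  by apply: IH; rewrite addnS.
Qed.

Lemma schwartz_phase_mult (u a : R) (f : R -> C) :
  schwartz f -> schwartz (fun x => Cmult (phase u a x) (f x)).
Proof.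
  move=> [hC hb].
  have hf : smooth f by move=> k x; case: (hC k k x (leqnn k) I).
  split; first by move=> m; apply: smooth_Ck; apply: smooth_phase_mult.
  (* A derivative of order [k <= N] of the product costs [k] twists, hence [k] extra orders on
     [f]. *)
  move=> N; have [B hB] := hb (N + N)%N.
  exists ((1 + Rabs u) ^ N * B) => j k x hj hk.
  rewrite CDerive_n_phase_mult // Cmod_mult Cmod_phase Rmult_1_l.
  have hB' : schwartz_bound (k + N) f B.
    move=> j' k' y hj' hk'; apply: hB.
      by apply: leq_trans hj' _; rewrite leq_add2r.
    by apply: leq_trans hk' _; rewrite leq_add2r.
  have := schwartz_bound_iter_twist u f N k B hf hB' j 0%N x hj (leq0n N).
  rewrite CDerive_n0 => h; apply: Rle_trans h _.
  apply: Rmult_le_compat_r.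
    (* [B] is nonnegative, since it dominates a nonnegative quantity at order 0 and at the point
       0. *)
    apply: Rle_trans (hB 0%N 0%N 0 (leq0n _) (leq0n _)).
    by apply: Rmult_le_pos; [exact: Rabs_pos | exact: Cmod_ge_0].
  apply: Rle_pow; last by apply/leP.
  by have := Rabs_pos u; lra.
Qed.

(** * Tensor products and the weak characteristic function of the standardised sum *)

Lemma tensor_phase (n : nat) (u a : R) (x : 'I_n -> R) :
  tensor (fun _ y => phase u a y) x =
  Cexp (Cmult Ci (RtoC (u * (\big[Rplus/0]_(i < n) x i - INR n * a)))).
Proof.
  rewrite /tensor; elim: n x => [|n IH] x.
    rewrite !big_ord0 /Cexp /RtoC /=.
    have -> : 0 * (u * (0 - 0 * a)) - 1 * 0 = 0 by ring.
    have -> : 0 * 0 + 1 * (u * (0 - 0 * a)) = 0 by ring.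
    rewrite exp_0 cos_0 sin_0; congr pair; ring.
  rewrite !big_ord_recl IH /phase -Cexp_plus; congr Cexp.
  rewrite S_INR /Cplus /Cmult /RtoC /=; congr pair; ring.
Qed.

Lemma tensor_mult (n : nat) (f g : 'I_n -> R -> C) (x : 'I_n -> R) :
  Cmult (tensor f x) (tensor g x) = tensor (fun i y => Cmult (f i y) (g i y)) x.
Proof.
  rewrite /tensor; apply: (big_rec3 (fun a b c => Cmult a b = c)).
    by rewrite Cmult_1_l.
  by move=> i a b c _ <-; rewrite /Cmult /=; congr pair; ring.
Qed.

Lemma Cprod_Cexp (n : nat) (z : C) :
  \big[Cmult/RtoC 1]_(i < n) Cexp z = Cexp (Cmult (RtoC (INR n)) z).
Proof.
  elim: n => [|n IH].
    rewrite big_ord0 Cmult_0_l /Cexp /= exp_0 cos_0 sin_0 /RtoC; congr pair; ring.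
  rewrite big_ord_recl IH -Cexp_plus S_INR; congr Cexp.
  rewrite /Cplus /Cmult /RtoC /=; congr pair; ring.
Qed.

Lemma phase_split (u a x : R) :
  phase u a x = Cmult (Cexp (0, - (u * a))) (Cexp (Cmult Ci (RtoC (u * x)))).
Proof.
  rewrite -Cexp_plus /phase; congr Cexp.
  rewrite /Cplus /Cmult /RtoC /=; congr pair; ring.
Qed.

(** The centering factor [e^{-iua}] does not depend on [x], so it leaves [T] by homogeneity; what
    remains is a test function, being the phase product with [a = 0]. *)
Lemma weak_cf_shift (T : (R -> C) -> C) (phi : R -> C) (u a : R) :
  tempered T -> schwartz phi ->
  T (fun x => Cmult (phase u a x) (phi x)) =
  Cmult (Cexp (0, - (u * a))) (weak_cf T phi (fun x => x) u).
Proof.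
  move=> [_ [hscal _]] hphi.
  have h : schwartz (fun x => Cmult (Cexp (Cmult Ci (RtoC (u * x)))) (phi x)).
    have -> : (fun x => Cmult (Cexp (Cmult Ci (RtoC (u * x)))) (phi x)) =
              (fun x => Cmult (phase u 0 x) (phi x)).
      by apply: functional_extensionality => x; rewrite /phase Rminus_0_r.
    exact: schwartz_phase_mult.
  rewrite /weak_cf -(hscal _ _ h); congr T; apply: functional_extensionality => x.
  by rewrite phase_split Cmult_assoc.
Qed.

(** Any logarithm [z] of the one-variable value will do: the [n]-th power of [Cexp z] is
    [Cexp (n z)] whichever branch [z] comes from. *)
Lemma weak_cf_Zstd (T : (R -> C) -> C) (phi : R -> C) (n : nat)
    (Tn : (('I_n -> R) -> C) -> C) (k1 k2 t : R) (z : C) :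
  tempered T -> schwartz phi -> is_tensor_power T Tn ->
  weak_cf T phi (fun x => x) (t / sqrt (INR n * k2)) = Cexp z ->
  weak_cf Tn (tensor (fun _ : 'I_n => phi)) (Zstd k1 k2 n) t =
  Cexp (Cmult (RtoC (INR n)) (Cplus z (0, - (t / sqrt (INR n * k2) * k1)))).
Proof.
  set u := t / _ => hT hphi [_ hTn] hz.
  rewrite /weak_cf.
  have -> : (fun x : 'I_n -> R => Cmult (Cexp (Cmult Ci (RtoC (t * Zstd k1 k2 n x))))
               (tensor (fun _ => phi) x)) =
            tensor (fun _ y => Cmult (phase u k1 y) (phi y)).
    apply: functional_extensionality => x.
    rewrite -tensor_mult tensor_phase; congr (Cmult (Cexp (Cmult _ (RtoC _))) _).
    rewrite /Zstd /u /Rdiv; ring.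
  rewrite hTn; last by move=> i; exact: schwartz_phase_mult.
  by rewrite weak_cf_shift // hz -Cexp_plus Cprod_Cexp Cplus_comm.
Qed.

(** * Estimates for the exponential and Taylor's formula *)

Lemma Cmod_le_Rabs (z : C) : Cmod z <= Rabs (Re z) + Rabs (Im z).
Proof.
  have -> : z = Cplus (RtoC (Re z)) (Cmult Ci (RtoC (Im z))).
    case: z => x y; rewrite /Cplus /Cmult /RtoC /=; congr pair; ring.
  apply: Rle_trans (Cmod_triangle _ _) _.
  rewrite Cmod_mult !Cmod_R Cmod_Ci /RtoC /Re /Im /=.
  apply: Req_le; congr (Rabs _ + _); last rewrite Rmult_1_l; try congr Rabs; ring.
Qed.

Lemma Rabs_sub_le_of_derive (f df : R -> R) (M b : R) :
  (forall x, is_derive f x (df x)) -> (forall x, Rabs x <= Rabs b -> Rabs (df x) <= M) ->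
  Rabs (f b - f 0) <= M * Rabs b.
Proof.
  move=> hd hM.
  have [c [hc ->]] := MVT_gen f 0 b df (fun x _ => hd x)
    (fun x _ => proj2 (continuity_pt_filterlim f x)
      (ex_derive_continuous f x (ex_intro _ _ (hd x)))).
  rewrite Rminus_0_r Rabs_mult; apply: Rmult_le_compat_r; first exact: Rabs_pos.
  apply: hM; move: hc; rewrite /Rmin /Rmax; case: Rle_dec => _; split_Rabs; lra.
Qed.

(** With [z = a + ib] and [r = |z|], the terms [e^a (cos b - 1)], [e^a - 1] and [e^a sin b] are each
    at most [e^r r] in absolute value by the mean value theorem; this gives the factor 3. *)
Lemma Cmod_Cexp_sub_1 (z : C) :
  Cmod (Cminus (Cexp z) (RtoC 1)) <= 3 * exp (Cmod z) * Cmod z.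
Proof.
  have hre := re_le_Cmod z; have him := Rmax_Cmod z.
  have {}him : Rabs (Im z) <= Cmod z by apply: Rle_trans him; exact: Rmax_r.
  set r := Cmod z in hre him *.
  have hr : 0 <= r by exact: Cmod_ge_0.
  have hexp : forall x, x <= r -> exp x <= exp r.
    by move=> x [/exp_increasing | ->]; lra.
  have he : Rabs (exp (Re z) - 1) <= exp r * Rabs (Re z).
    rewrite -{1}exp_0; apply: (Rabs_sub_le_of_derive exp exp); first exact: is_derive_exp.
    move=> x hx; rewrite Rabs_pos_eq; last by apply: Rlt_le; exact: exp_pos.
    apply: hexp; split_Rabs; lra.
  have hc : Rabs (cos (Im z) - 1) <= 1 * Rabs (Im z).
    rewrite -{1}cos_0; apply: (Rabs_sub_le_of_derive cos (fun x => - sin x)).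
      exact: is_derive_cos.
    by move=> x _; have := SIN_bound x; split_Rabs; lra.
  have hs : Rabs (sin (Im z) - 0) <= 1 * Rabs (Im z).
    rewrite -{1}sin_0; apply: (Rabs_sub_le_of_derive sin cos).
      exact: is_derive_sin.
    by move=> x _; have := COS_bound x; split_Rabs; lra.
  have {}hc : Rabs (cos (Im z) - 1) <= r by lra.
  have {}hs : Rabs (sin (Im z) - 0) <= r by lra.
  apply: Rle_trans (Cmod_le_Rabs _) _.
  rewrite /Cexp /Cminus /Cplus /Copp /RtoC /=.
  have -> : exp (Re z) * cos (Im z) + - (1) =
    exp (Re z) * (cos (Im z) - 1) + (exp (Re z) - 1) by ring.
  have -> : exp (Re z) * sin (Im z) + - 0 = exp (Re z) * (sin (Im z) - 0) by ring.
  have h1 := Rabs_triang (exp (Re z) * (cos (Im z) - 1)) (exp (Re z) - 1).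
  rewrite !Rabs_mult (Rabs_pos_eq (exp _)) in h1 *; try by apply: Rlt_le; exact: exp_pos.
  have h2 : exp (Re z) <= exp r by apply: hexp; split_Rabs; lra.
  have h3 := exp_pos (Re z).
  have := Rmult_le_compat _ _ _ _ (Rlt_le _ _ h3) (Rabs_pos (cos (Im z) - 1)) h2 hc.
  have := Rmult_le_compat _ _ _ _ (Rlt_le _ _ h3) (Rabs_pos (sin (Im z) - 0)) h2 hs.
  have := Rmult_le_compat_l (exp r) _ _ (Rlt_le _ _ (exp_pos r)) hre.
  lra.
Qed.

(** The Lagrange remainder is available for real functions, so this is meant for [Re K] and [Im K]
    separately. Applying it to [y |-> f (u y)] on [[0, 1]] treats both signs of [u] at once. *)
Lemma Taylor_3_bound (f : R -> R) (d M : R) :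
  (forall k t, (k <= 3)%N -> Rabs t < d -> ex_derive_n f k t) ->
  (forall t, Rabs t < d -> Rabs (Derive_n f 3 t) <= M) ->
  forall u, Rabs u < d ->
  Rabs (f u - (f 0 + u * Derive_n f 1 0 + u ^ 2 / 2 * Derive_n f 2 0)) <= M * Rabs u ^ 3.
Proof.
  move=> hf hM u hu.
  have hd : 0 < d by have := Rabs_pos u; lra.
  have hsmall : forall t, 0 <= t <= 1 -> Rabs (u * t) < d.
    move=> t ht; rewrite Rabs_mult (Rabs_pos_eq t); last lra.
    have := Rabs_pos u; nra.
  have hloc : forall t, 0 <= t <= 1 ->
      locally (u * t) (fun y => forall k, (k <= 3)%coq_nat -> ex_derive_n f k y).
    move=> t ht.
    have he : 0 < d - Rabs (u * t) by have := hsmall t ht; lra.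
    exists (mkposreal _ he) => y hy k hk; apply: hf; first by apply/leP.
    move: hy; rewrite /ball /= /AbsRing_ball /abs /minus /plus /opp /=.
    split_Rabs; lra.
  have hloc' : forall m t, (m <= 3)%coq_nat -> 0 <= t <= 1 ->
      locally (u * t) (fun y => forall k, (k <= m)%coq_nat -> ex_derive_n f k y).
    move=> m t hm ht; apply: filter_imp (hloc t ht) => y hy k hk; apply: hy; lia.
  have [|c [hc]] := Taylor_Lagrange (fun y => f (u * y)) 2 0 1 Rlt_0_1.
    move=> t ht k hk; apply: ex_derive_n_comp_scal; exact: hloc'.
  rewrite /sum_f_R0.
  rewrite !Derive_n_comp_scal; try (apply: hloc'; [lia | lra]).
  have hMc := hM (u * c) (hsmall c ltac:(lra)).
  rewrite !Rmult_0_r Rmult_1_r => ->.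
  rewrite !INR_IZR_INZ /Factorial.fact /Nat.mul /Nat.add /Z.of_nat /Pos.of_succ_nat /Pos.succ.
  rewrite [Derive_n f 0 0]/=.
  (* The remainder carries a factor [1 / 6], which the final bound gives away. *)
  have -> : forall a b c e : R, (1 - 0) ^ 0 / 1 * (u ^ 0 * a) + (1 - 0) ^ 1 / 1 * (u ^ 1 * b) +
     (1 - 0) ^ 2 / 2 * (u ^ 2 * c) + (1 - 0) ^ 3 / 6 * (u ^ 3 * e) -
     (a + u * b + u ^ 2 / 2 * c) = e * u ^ 3 / 6 by move=> *; field.
  rewrite /Rdiv (Rabs_mult _ (/ 6)) (Rabs_mult _ (u ^ 3)) -RPow_abs (Rabs_pos_eq (/ 6)); last lra.
  have := Rmult_le_compat_r _ _ _ (pow_le _ 3 (Rabs_pos u)) hMc.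
  have := Rmult_le_pos _ _ (Rabs_pos (Derive_n f 3 (u * c))) (pow_le _ 3 (Rabs_pos u)).
  lra.
Qed.

(** * Uniqueness of the continuous branch of the logarithm *)

(** The retraction of the line onto [[-r, r]]. It extends a branch known on that interval to the
    whole line, where [IVT_gen] wants continuity. *)
Definition clamp (r s : R) : R := Rmax (- r) (Rmin r s).

Lemma Rabs_clamp (r s : R) : 0 < r -> Rabs (clamp r s) <= r.
Proof. by move=> hr; rewrite /clamp /Rmin; case: Rle_dec => ?; rewrite /Rmax; case: Rle_dec => ?; split_Rabs; lra. Qed.

Lemma clamp_id (r s : R) : Rabs s <= r -> clamp r s = s.
Proof. by move=> h; rewrite /clamp /Rmin; case: Rle_dec => ?; rewrite /Rmax; case: Rle_dec => ?; split_Rabs; lra. Qed.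

Lemma continuous_clamp (r s : R) : continuous (clamp r) s.
Proof.
  apply/filterlim_locally => eps; exists eps => y.
  rewrite /ball /= /AbsRing_ball /abs /minus /plus /opp /= /clamp.
  by rewrite /Rmin; repeat destruct (Rle_dec r _); rewrite /Rmax;
    repeat destruct (Rle_dec (- r) _); split_Rabs; lra.
Qed.

(** [continuous_on] gives only a limit within the closed interval. Since [clamp r] never leaves it,
    this is enough, also at the endpoints. *)
Lemma continuous_clamp_comp (r : R) (L : R -> C) (s : R) : 0 < r ->
  continuous_on (fun t => Rabs t <= r) L -> continuous (fun s => L (clamp r s)) s.
Proof.
  move=> hr hL.
  move=> P /(hL _ (Rabs_clamp r s hr)) hP.
  have [e he] := continuous_clamp r s _ hP.
  by exists e => y hy; apply: he => //; exact: Rabs_clamp.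
Qed.

(** The cosine condition says that the imaginary parts differ by a multiple of [2 PI], without
    naming the integer. *)
Lemma Cexp_inj_mod (z w : C) : Cexp z = Cexp w -> Re z = Re w /\ cos (Im z - Im w) = 1.
Proof.
  rewrite /Cexp => -[hc hs].
  have h1 := sin2_cos2 (Im z); have h2 := sin2_cos2 (Im w); rewrite /Rsqr in h1 h2.
  have e1 := exp_pos (Re z); have e2 := exp_pos (Re w).
  (* Compare squared moduli, using [cos^2 + sin^2 = 1]. *)
  have e : exp (Re z) = exp (Re w).
    apply: Rsqr_inj; try lra; rewrite /Rsqr.
    rewrite -[LHS]Rmult_1_r -[RHS]Rmult_1_r -{1}h1 -h2.
    transitivity ((exp (Re z) * cos (Im z)) ^ 2 + (exp (Re z) * sin (Im z)) ^ 2); first ring.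
    rewrite hc hs; ring.
  rewrite e in hc hs.
  have {}hc := Rmult_eq_reg_l _ _ _ hc (Rgt_not_eq _ _ e2).
  have {}hs := Rmult_eq_reg_l _ _ _ hs (Rgt_not_eq _ _ e2).
  split; first exact: exp_inv.
  rewrite cos_minus hc hs; lra.
Qed.

(** The distance [g] between the imaginary parts is continuous, vanishes at 0 and satisfies
    [cos g = 1] everywhere, so it cannot leave 0. *)
Lemma log_branch_unique (r : R) (f L1 L2 : R -> C) : 0 < r ->
  log_branch (fun t => Rabs t <= r) f L1 -> log_branch (fun t => Rabs t <= r) f L2 ->
  forall t, Rabs t <= r -> L1 t = L2 t.
Proof.
  move=> hr [h10 [h1c h1]] [h20 [h2c h2]] t ht.
  have hexp : forall s, Rabs s <= r -> Re (L1 s) = Re (L2 s) /\ cos (Im (L1 s) - Im (L2 s)) = 1.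
    by move=> s hs; apply: Cexp_inj_mod; rewrite h1 // h2.
  pose g s := Rabs (Im (L1 (clamp r s)) - Im (L2 (clamp r s))).
  have hg : continuity g.
    move=> s; apply/continuity_pt_filterlim.
    have hIm : forall L, continuous_on (fun t => Rabs t <= r) L ->
        continuous (fun s => Im (L (clamp r s))) s.
      move=> L hL; exact: filterlim_comp (continuous_clamp_comp r L s hr hL) (filterlim_Im _).
    exact: (continuous_Rabs_comp _ _ (continuous_minus (V := R_NormedModule) _ _ _ (hIm _ h1c) (hIm _ h2c))).
  have hg0 : g 0 = 0.
    by rewrite /g clamp_id ?h10 ?h20 ?Rminus_diag ?Rabs_R0 //; lra.
  have hgt : g t = Rabs (Im (L1 t) - Im (L2 t)) by rewrite /g clamp_id.
  have hcos : forall s, cos (g s) = 1.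
    move=> s; rewrite /g; have [_ h] := hexp _ (Rabs_clamp r s hr).
    by rewrite /Rabs; case: Rcase_abs => _; rewrite ?cos_neg.
  suff : g t = 0.
    rewrite hgt => h0; have [hre _] := hexp t ht.
    have : Im (L1 t) = Im (L2 t) by move: h0; split_Rabs; lra.
    by move: hre; case: (L1 t) => ? ?; case: (L2 t) => ? ? /= -> ->.
  have [//|hpos] := Req_dec (g t) 0.
  have {}hpos : 0 < g t by have := Rabs_pos (Im (L1 (clamp r t)) - Im (L2 (clamp r t))); rewrite -/(g t); lra.
  have hpi := PI_RGT_0.
  (* If [g t > 0], then [g] takes a value in [(0, PI]], where the cosine is strictly below 1. *)
  have [|x [_ hx]] := IVT_gen g 0 t (Rmin (g t) PI) hg.
    by rewrite hg0 /Rmin /Rmax; repeat case: Rle_dec => ?; lra.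
  have hy : 0 < Rmin (g t) PI <= PI by rewrite /Rmin; case: Rle_dec => ?; lra.
  have := hcos x; rewrite hx.
  have := cos_decreasing_1 0 (Rmin (g t) PI).
  rewrite cos_0; lra.
Qed.

(** * Third-order expansion of [K] and the uniform bound on the logarithm *)

Lemma continuous_locally_bounded (g : R -> R) : continuous g 0 ->
  exists d, 0 < d /\ forall t, Rabs t < d -> Rabs (g t) <= Rabs (g 0) + 1.
Proof.
  move=> /filterlim_locally hg.
  have [d hd] := hg (mkposreal 1 Rlt_0_1).
  exists d; split=> [|t ht]; first exact: cond_pos.
  have := hd t; rewrite /ball /= /AbsRing_ball /abs /minus /plus /opp /=.
  rewrite Ropp_0 Rplus_0_r => /(_ ht); split_Rabs; lra.
Qed.

(** The cumulants give [K'(0) = i k1] and [K''(0) = - k2], so the modulus is that of the Taylor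
    remainder of order 3; the pair [(0, - (u * k1))] is [- i u k1]. *)
Lemma cumulant_expansion (K : R -> C) (delta k1 k2 : R) : 0 < delta ->
  Ck_on (fun t => Rabs t < delta) 3 K -> K 0 = RtoC 0 ->
  weak_cumulant K 1 = RtoC k1 -> weak_cumulant K 2 = RtoC k2 ->
  exists d M, 0 < d <= delta /\ 0 <= M /\ forall u, Rabs u < d ->
    Cmod (Cplus (Cplus (K u) (0, - (u * k1))) (RtoC (k2 * u ^ 2 / 2))) <= M * Rabs u ^ 3.
Proof.
  move=> hdelta hC h0 hk1 hk2.
  have hD1 : CDerive_n K 1 0 = (0, k1).
    have -> : CDerive_n K 1 0 = Cmult Ci (weak_cumulant K 1).
      rewrite /weak_cumulant; case: (CDerive_n K 1 0) => x y.
      rewrite /Cpow /Cinv /Cmult /Ci /RtoC /=; congr pair; field.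
    rewrite hk1 /Cmult /Ci /RtoC /=; congr pair; ring.
  have hD2 : CDerive_n K 2 0 = (- k2, 0).
    have -> : CDerive_n K 2 0 = Copp (weak_cumulant K 2).
      rewrite /weak_cumulant; case: (CDerive_n K 2 0) => x y.
      rewrite /Cpow /Cinv /Cmult /Copp /Ci /RtoC /=; congr pair; field.
    rewrite hk2 /Copp /RtoC /=; congr pair; ring.
  case: hD1 => hr1 hi1; case: hD2 => hr2 hi2.
  have hz : Rabs 0 < delta by rewrite Rabs_R0.
  have [_ hc] := hC 3%N 0 isT hz.
  have [d1 [hd1 hb1]] := continuous_locally_bounded _ (filterlim_comp _ _ _ _ _ _ _ _ hc (filterlim_Re _)).
  have [d2 [hd2 hb2]] := continuous_locally_bounded _ (filterlim_comp _ _ _ _ _ _ _ _ hc (filterlim_Im _)).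
  (* Continuity of the third derivative at 0 bounds its two components only near 0, hence the
     smaller radius. *)
  pose d := Rmin delta (Rmin d1 d2).
  have hd : 0 < d by rewrite /d; repeat apply: Rmin_pos.
  have hdd : d <= delta by exact: Rmin_l.
  have hdd1 : d <= d1 by apply: Rle_trans (Rmin_r _ _) (Rmin_l _ _).
  have hdd2 : d <= d2 by apply: Rle_trans (Rmin_r _ _) (Rmin_r _ _).
  set M1 := _ + 1 in hb1; set M2 := _ + 1 in hb2.
  exists d, (M1 + M2); split; first by [].
  have hM1 : 0 <= M1 by rewrite /M1; have := Rabs_pos (Re (CDerive_n K 3 0)); lra.
  have hM2 : 0 <= M2 by rewrite /M2; have := Rabs_pos (Im (CDerive_n K 3 0)); lra.
  split; first lra.
  move=> u hu.
  have tr := Taylor_3_bound (fun t => Re (K t)) d M1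
    (fun k t hk ht => proj1 (proj1 (hC k t hk (Rlt_le_trans _ _ _ ht hdd))))
    (fun t ht => hb1 t (Rlt_le_trans _ _ _ ht hdd1)) u hu.
  have ti := Taylor_3_bound (fun t => Im (K t)) d M2
    (fun k t hk ht => proj2 (proj1 (hC k t hk (Rlt_le_trans _ _ _ ht hdd))))
    (fun t ht => hb2 t (Rlt_le_trans _ _ _ ht hdd2)) u hu.
  apply: Rle_trans (Cmod_le_Rabs _) _; rewrite Rmult_plus_distr_r.
  have {}hr1 : Derive_n (fun t => Re (K t)) 1 0 = 0 by [].
  have {}hi1 : Derive_n (fun t => Im (K t)) 1 0 = k1 by [].
  have {}hr2 : Derive_n (fun t => Re (K t)) 2 0 = - k2 by [].
  have {}hi2 : Derive_n (fun t => Im (K t)) 2 0 = 0 by [].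
  rewrite hr1 hr2 h0 in tr; rewrite hi1 hi2 h0 in ti.
  apply: Rplus_le_compat.
  - apply: Rle_trans tr; apply: Req_le; congr Rabs.
    rewrite /RtoC /Re /=; field.
  - apply: Rle_trans ti; apply: Req_le; congr Rabs.
    rewrite /RtoC /Im /=; field.
Qed.

(* The paper's formula for [log phi_{Z_n}], valid where [K] is defined. *)
Definition logZ_formula (K : R -> C) (k1 k2 : R) (n : nat) (t : R) : C :=
  Cmult (RtoC (INR n))
    (Cplus (K (t / sqrt (INR n * k2))) (0, - (t / sqrt (INR n * k2) * k1))).

(** Multiply the expansion at [u = t / sqrt (n k2)] by [n]: the quadratic term becomes exactly
    [t^2 / 2], and the remainder is at most [n M |u|^3]. *)
Lemma logZ_formula_bound (K : R -> C) (k1 k2 d M tau : R) :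
  0 < k2 -> 0 < d -> 0 <= M -> 0 < tau ->
  (forall u, Rabs u < d ->
    Cmod (Cplus (Cplus (K u) (0, - (u * k1))) (RtoC (k2 * u ^ 2 / 2))) <= M * Rabs u ^ 3) ->
  exists A, 0 <= A /\ eventually (fun n => (0 < INR n) /\ forall t, Rabs t <= tau ->
    Rabs (t / sqrt (INR n * k2)) < d /\
    Cmod (Cplus (logZ_formula K k1 k2 n t) (RtoC (t ^ 2 / 2))) <= A / sqrt (INR n)).
Proof.
  move=> hk2 hd hM htau hK.
  (* This is [n M |u|^3 sqrt n] at [|t| = tau]. *)
  exists (M * tau ^ 3 / (k2 * sqrt k2)).
  have hsk := sqrt_lt_R0 k2 hk2.
  split.
    apply: Rmult_le_pos; first by apply: Rmult_le_pos => //; apply: pow_le; lra.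
    by apply: Rlt_le; apply: Rinv_0_lt_compat; apply: Rmult_lt_0_compat.
  (* Beyond this threshold [tau / sqrt (n k2) < d], so [u] stays in the range of the expansion for
     every [|t| <= tau]; the maximum with 0 makes [n] positive. *)
  have [N hN] := INR_unbounded (Rmax 0 ((tau / d) ^ 2 / k2)).
  exists N => n /le_INR hn.
  have hn0 : 0 < INR n by have := Rmax_l 0 ((tau / d) ^ 2 / k2); lra.
  have hnd : (tau / d) ^ 2 / k2 < INR n by have := Rmax_r 0 ((tau / d) ^ 2 / k2); lra.
  split=> // t ht.
  have hnk : 0 < INR n * k2 by apply: Rmult_lt_0_compat.
  have hs := sqrt_lt_R0 _ hnk.
  have hss := sqrt_sqrt _ (Rlt_le _ _ hnk).
  have hsn := sqrt_lt_R0 _ hn0.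
  have hsm : sqrt (INR n * k2) = sqrt (INR n) * sqrt k2 by apply: sqrt_mult; lra.
  set s := sqrt (INR n * k2) in hs hss hsm *.
  have hsd : tau / d < s.
    apply: Rsqr_incrst_0; last 2 first; try lra.
    - by apply: Rlt_le; apply: Rdiv_lt_0_compat.
    rewrite /Rsqr hss.
    have := Rmult_lt_compat_r _ _ _ hk2 hnd.
    have -> : (tau / d) ^ 2 / k2 * k2 = (tau / d) * (tau / d) by field; lra.
    by [].
  have hu : Rabs (t / s) = Rabs t / s.
    by rewrite /Rdiv Rabs_mult Rabs_inv (Rabs_pos_eq s) //; lra.
  have hud : Rabs (t / s) < d.
    rewrite hu; apply: (Rmult_lt_reg_r s) => //.
    have -> : Rabs t / s * s = Rabs t by field; lra.
    have := Rmult_lt_compat_r _ _ _ hd hsd.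
    have -> : tau / d * d = tau by field; lra.
    lra.
  split=> //.
  have -> : Cplus (logZ_formula K k1 k2 n t) (RtoC (t ^ 2 / 2)) =
    Cmult (RtoC (INR n)) (Cplus (Cplus (K (t / s)) (0, - (t / s * k1)))
      (RtoC (k2 * (t / s) ^ 2 / 2))).
    rewrite /logZ_formula -/s [RHS]Cmult_plus_distr_l; congr Cplus.
    rewrite -RtoC_mult; congr RtoC.
    have -> : INR n * (k2 * (t / s) ^ 2 / 2) = (INR n * k2) * t ^ 2 / (s * s) / 2 by field; lra.
    rewrite hss; field; lra.
  rewrite Cmod_mult Cmod_R Rabs_pos_eq; last lra.
  have h1 := Rmult_le_compat_l _ _ _ (Rlt_le _ _ hn0) (hK _ hud).
  apply: Rle_trans h1 _; rewrite hu.
  (* Both sides are given the same shape, so that only [|t|^3 <= tau^3] remains. *)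
  have -> : INR n * (M * (Rabs t / s) ^ 3) = (INR n / (s * s)) * (M * Rabs t ^ 3) / s
    by field; lra.
  have -> : M * tau ^ 3 / (k2 * sqrt k2) / sqrt (INR n) = (INR n / (s * s)) * (M * tau ^ 3) / s.
    rewrite hss hsm; field; lra.
  apply: Rmult_le_compat_r; first by apply: Rlt_le; apply: Rinv_0_lt_compat.
  apply: Rmult_le_compat_l.
    by rewrite hss; apply: Rlt_le; apply: Rdiv_lt_0_compat.
  apply: Rmult_le_compat_l => //; apply: pow_incr; split=> //; exact: Rabs_pos.
Qed.

Lemma continuous_logZ_formula (K : R -> C) (k1 k2 : R) (n : nat) (t : R) :
  continuous K (t / sqrt (INR n * k2)) -> continuous (logZ_formula K k1 k2 n) t.
Proof.
  move=> hK; set s := sqrt (INR n * k2) in hK *.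
  have hs : continuous (fun t => t / s) t.
    by apply: (ex_derive_continuous (fun t => t / s)); auto_derive.
  have hKs := continuous_comp (fun t => t / s) K t hs hK.
  have hr : continuous (fun t => INR n * Re (K (t / s))) t.
    apply: (continuous_scal_r (V := R_NormedModule) (INR n)).
    exact: filterlim_comp hKs (filterlim_Re _).
  have hi : continuous (fun t => INR n * (Im (K (t / s)) - t / s * k1)) t.
    apply: (continuous_scal_r (V := R_NormedModule) (INR n)).
    apply: (continuous_minus (V := R_NormedModule)).
      exact: filterlim_comp hKs (filterlim_Im _).
    by apply: (ex_derive_continuous (fun t => t / s * k1)); auto_derive.
  have -> : logZ_formula K k1 k2 n =
    (fun t => (INR n * Re (K (t / s)), INR n * (Im (K (t / s)) - t / s * k1))).
    apply: functional_extensionality => x.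
    rewrite /logZ_formula -/s /Cmult /Cplus /RtoC /Re /Im /=; congr pair; ring.
  exact: filterlim_C_pair.
Qed.

Lemma log_branch_logZ_formula (f K : R -> C) (k1 k2 tau : R) (n : nat) :
  K 0 = RtoC 0 ->
  (forall t, Rabs t <= tau -> continuous K (t / sqrt (INR n * k2))) ->
  (forall t, Rabs t <= tau -> f t = Cexp (logZ_formula K k1 k2 n t)) ->
  log_branch (fun t => Rabs t <= tau) f (logZ_formula K k1 k2 n).
Proof.
  move=> h0 hK hf; split; last split.
  - rewrite /logZ_formula; have -> : 0 / sqrt (INR n * k2) = 0 by rewrite /Rdiv Rmult_0_l.
    rewrite h0 /Cmult /Cplus /RtoC /=; congr pair; ring.
  - move=> t ht.
    apply: (filterlim_filter_le_1 _ (filter_le_within _)); exact: (continuous_logZ_formula K k1 k2 n t (hK t ht)).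
  - by move=> t /hf.
Qed.

(** Write [e^z - e^x = e^x (e^(z - x) - 1)] with [e^x <= 1]. The cap [B] on [|z - x|] makes the
    constant uniform. *)
Lemma Cmod_Cexp_sub_exp (z : C) (x B : R) :
  x <= 0 -> Cmod (Cplus z (RtoC (- x))) <= B ->
  Cmod (Cminus (Cexp z) (RtoC (exp x))) <= 3 * exp B * Cmod (Cplus z (RtoC (- x))).
Proof.
  move=> hx; set w := Cplus _ _ => hw.
  have -> : Cminus (Cexp z) (RtoC (exp x)) = Cmult (Cminus (Cexp w) (RtoC 1)) (RtoC (exp x)).
    have -> : Cexp z = Cmult (Cexp w) (RtoC (exp x)).
      have -> : RtoC (exp x) = Cexp (RtoC x).
        rewrite /Cexp /RtoC /= cos_0 sin_0; congr pair; ring.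
      rewrite -Cexp_plus /w; congr Cexp; case: z {w hw} => a b.
      rewrite /Cplus /RtoC /=; congr pair; ring.
    ring.
  rewrite Cmod_mult Cmod_R Rabs_pos_eq; last by apply: Rlt_le; exact: exp_pos.
  have hex : exp x <= 1.
    by rewrite -exp_0; case: hx => [/exp_increasing | ->]; lra.
  have heB : exp (Cmod w) <= exp B by case: hw => [/exp_increasing | ->]; lra.
  have h1 := Cmod_Cexp_sub_1 w; have h2 := Cmod_ge_0 w; have h3 := exp_pos x.
  have h4 := Cmod_ge_0 (Cminus (Cexp w) (RtoC 1)).
  have := Rmult_le_compat_r _ _ _ h2 heB.
  have := Rmult_le_compat_l _ _ _ h4 hex.
  lra.
Qed.

(** * From pointwise bounds to suprema, and the conclusion *)

Lemma O_inv_sqrt_sup_le (tau A : R) (h : nat -> R -> R) :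
  eventually (fun n => forall t, Rabs t <= tau -> h n t <= A / sqrt (INR n)) ->
  O_inv_sqrt (fun n => sup_le tau (h n)).
Proof.
  move=> he; exists A; apply: filter_imp he => n hn.
  have [_ hlub] := Lub_Rbar_correct (fun y => exists t, Rabs t <= tau /\ y = h n t).
  by apply: hlub => y [t [ht ->]]; exact: hn.
Qed.

Theorem theorem8p2
  (T : (R -> C) -> C) (phi : R -> C)
  (hT : tempered T) (hphi : schwartz phi) (hnorm : T phi = RtoC 1)
  (TT : forall n : nat, (('I_n -> R) -> C) -> C)
  (Phi : forall n : nat, ('I_n -> R) -> C)
  (hiid : iid T phi TT Phi)
  (delta : R) (hdelta : 0 < delta) (K : R -> C)
  (hK : log_branch (fun t => Rabs t < delta) (weak_cf T phi (fun x => x)) K)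
  (hC3 : Ck_on (fun t => Rabs t < delta) 3 K)
  (kappa1 kappa2 : R)
  (hkappa1 : weak_cumulant K 1 = RtoC kappa1)
  (hkappa2 : weak_cumulant K 2 = RtoC kappa2)
  (hkappa2_pos : 0 < kappa2)
  (tau : R) (htau : 0 < tau) :
  let phiZ (n : nat) : R -> C :=
    weak_cf (TT n) (Phi n) (Zstd kappa1 kappa2 n) in
  let logZ (n : nat) (L : R -> C) : Prop :=
    log_branch (fun t => Rabs t <= tau) (phiZ n) L in
  (eventually (fun n => exists L : R -> C, logZ n L) /\
   forall L : nat -> R -> C, eventually (fun n => logZ n (L n)) ->
     O_inv_sqrt (fun n =>
       sup_le tau (fun t => Cmod (Cplus (L n t) (RtoC (t ^ 2 / 2)))))) /\
  O_inv_sqrt (fun n =>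
    sup_le tau (fun t => Cmod (Cminus (phiZ n t) (RtoC (exp (- t ^ 2 / 2)))))).
Proof.
  move=> phiZ logZ.
  have [hK0 [hKc hKexp]] := hK.
  have [d [M [[hd hdd] [hM hexpand]]]] :=
    cumulant_expansion K delta kappa1 kappa2 hdelta hC3 hK0 hkappa1 hkappa2.
  have [A [hA hev]] :=
    logZ_formula_bound K kappa1 kappa2 d M tau hkappa2_pos hd hM htau hexpand.
  have hphiZ : forall n t, Rabs (t / sqrt (INR n * kappa2)) < d ->
      phiZ n t = Cexp (logZ_formula K kappa1 kappa2 n t).
    move=> n t ht; have [hTn hPhi] := hiid n.
    rewrite /phiZ hPhi; apply: weak_cf_Zstd hT hphi hTn _.
    by rewrite hKexp //; lra.
  have hlog : eventually (fun n => logZ n (logZ_formula K kappa1 kappa2 n)).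
    apply: filter_imp hev => n [_ hn].
    apply: log_branch_logZ_formula => // t /hn [ht _]; last exact: hphiZ.
    (* Order 0 of the [C^3] hypothesis gives continuity of [K] in full neighbourhoods, not just
       within the domain. *)
    have -> : K = CDerive_n K 0 by apply: functional_extensionality => x; rewrite CDerive_n0.
    by apply: (proj2 (hC3 0%N _ _ _)) => //; lra.
  split; first split.
  - by apply: filter_imp hlog => n hn; exists (logZ_formula K kappa1 kappa2 n).
  (* An arbitrary branch coincides with the explicit formula on [[-tau, tau]], so the constant [A]
     carries over. *)
  - move=> L hL; apply: (O_inv_sqrt_sup_le _ A).
    apply: filter_imp (filter_and _ _ hL (filter_and _ _ hlog hev)) => n [hLn [hn [_ hb]]] t ht.
    rewrite (log_branch_unique tau (phiZ n) _ _ htau hLn hn t ht).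
    by case: (hb t ht).
  (* For [n >= 1] the exponent error is at most [A / sqrt n <= A]; [exp A] then bounds the
     exponential factor for all such [n], and the remaining factor supplies the rate. *)
  - apply: (O_inv_sqrt_sup_le _ (3 * exp A * A)).
    have hev1 : eventually (fun n => (1 <= n)%coq_nat) by exists 1%N.
    apply: filter_imp (filter_and _ _ hev1 hev) => n [hn1 [hn0 hb]] t ht.
    have [hu hbt] := hb t ht.
    rewrite (hphiZ n t hu).
    have hsq : 1 <= sqrt (INR n) by rewrite -sqrt_1; apply: sqrt_le_1_alt; exact: (le_INR 1).
    have hx : RtoC (t ^ 2 / 2) = RtoC (- (- t ^ 2 / 2)) by congr RtoC; field.
    rewrite hx in hbt.
    have hAA : A / sqrt (INR n) <= A.
      rewrite -[X in _ <= X]Rdiv_1_r; apply: Rmult_le_compat_l => //.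
      apply: Rinv_le_contravar; lra.
    have := Cmod_Cexp_sub_exp (logZ_formula K kappa1 kappa2 n t) (- t ^ 2 / 2) A
      ltac:(have := pow2_ge_0 t; lra) ltac:(lra).
    have := exp_pos A; rewrite /Rdiv in hbt *; nra.
Qed.
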